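(* Suppose that $\mathsf{U}_{[1,\aleph_0)}(\Gamma,\mathrm{T})$ is preserved under taking finite unions (that is, whenever a set of reals $X$ is a union of finitely many subspaces each satisfying $\mathsf{U}_{[1,\aleph_0)}(\Gamma,\mathrm{T})$, then $X$ satisfies $\mathsf{U}_{[1,\aleph_0)}(\Gamma,\mathrm{T})$). Then $\mathsf{U}_{[1,\aleph_0)}(\Gamma,\mathrm{T})$ is equivalent to $\mathsf{U}_{fin}(\Gamma,\Gamma)$ (a set of reals satisfies one if and only if it satisfies the other), and $\mathsf{S}_1(\Gamma,\mathrm{T})$ implies $\mathsf{U}_{fin}(\Gamma,\Gamma)$ (every set of reals satisfying $\mathsf{S}_1(\Gamma,\mathrm{T})$ satisfies $\mathsf{U}_{fin}(\Gamma,\Gamma)$).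
   Context: A set of reals is an infinite, zero-dimensional, separable metrizable topological space $X$. A cover of $X$ is a family $\mathcal{U}$ of subsets of $X$ with $X\notin\mathcal{U}$ and $X=\bigcup\mathcal{U}$. A cover $\mathcal{U}$ of $X$ is: a large cover if for each $x\in X$ the set $\{U\in\mathcal{U}:x\in U\}$ is infinite; a $\tau$-cover if it is a large cover and for all $x,y\in X$ at least one of the sets $\{U\in\mathcal{U}:x\in U,\ y\notin U\}$, $\{U\in\mathcal{U}:y\in U,\ x\notin U\}$ is finite; a $\gamma$-cover if $\mathcal{U}$ is infinite and for each $x\in X$ the set $\{U\in\mathcal{U}:x\notin U\}$ is finite. $\mathrm{T},\Gamma$ denote the collections of all countable open $\tau$-covers and $\gamma$-covers of $X$, respectively. For collections $\mathscr{A},\mathscr{B}$ of covers of $X$: - $X$ satisfies $\mathsf{S}_1(\mathscr{A},\mathscr{B})$ if for each sequence $\langle\mathcal{U}_n:n\in\mathbb{N}\rangle$ of members of $\mathscr{A}$ there exist $U_n\in\mathcal{U}_n$, $n\in\mathbb{N}$, such that $\{U_n:n\in\mathbb{N}\}\in\mathscr{B}$. - $X$ satisfies $\mathsf{U}_{fin}(\mathscr{A},\mathscr{B})$ if for each sequence $\langle\mathcal{U}_n:n\in\mathbb{N}\rangle$ of members of $\mathscr{A}$ which do not contain a finite subcover, there exist finite (possibly empty) subsets $\mathcal{F}_n\subseteq\mathcal{U}_n$, $n\in\mathbb{N}$, such that $\{\bigcup\mathcal{F}_n:n\in\mathbb{N}\}\in\mathscr{B}$. - $X$ satisfies $\mathsf{U}_{[1,\aleph_0)}(\mathscr{A},\mathscr{B})$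 if for each sequence $\langle\mathcal{U}_n:n\in\mathbb{N}\rangle$ of members of $\mathscr{A}$ which do not contain a finite subcover, there exist finite nonempty subsets $\mathcal{F}_n\subseteq\mathcal{U}_n$, $n\in\mathbb{N}$, such that $\{\bigcup\mathcal{F}_n:n\in\mathbb{N}\}\in\mathscr{B}$. *)

(* Defs.v *)
From HB Require Import structures.
From mathcomp Require Import all_boot all_order all_algebra.
From mathcomp Require Import all_classical all_reals all_analysis.

Set Implicit Arguments.
Unset Strict Implicit.
Unset Printing Implicit Defensive.

Import Order.TTheory GRing.Theory Num.Theory.

Local Open Scope classical_set_scope.
Local Open Scope ring_scope.

Definition metrizable (R : realType) (X : topologicalType) : Prop :=
  exists d : X -> X -> R,
    [/\ forall x, d x x = 0,
        forall x y, d x y = 0 -> x = y,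
        forall x y, d x y = d y x,
        forall x y z, d x z <= d x y + d y z &
        forall (x : X) (A : set X),
          nbhs x A <-> exists2 e : R, 0 < e & [set y | d x y < e] `<=` A].

Definition separable (X : topologicalType) : Prop :=
  exists2 D : set X, countable D & dense D.

(* Zero-dimensionality in the sense of a base of clopen sets.  The library's
   [zero_dimensional] only asks that clopen sets separate points, which is
   weaker, even for separable metrizable spaces. *)
Definition clopen_base (X : topologicalType) : Prop :=
  forall (x : X) (A : set X), nbhs x A ->
    exists V : set X, [/\ clopen V, V x & V `<=` A].

Definition set_of_reals (R : realType) (X : topologicalType) : Prop :=
  [/\ infinite_set [set: X], clopen_base X, separable X & metrizable R X].

Section Covers.
Variable X : topologicalType.
Implicit Types U : set (set X).

Definition is_cover U : Prop :=
  ~ U [set: X] /\ \bigcup_(V in U) V = [set: X].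

Definition large_cover U : Prop :=
  is_cover U /\ forall x : X, infinite_set [set V | U V /\ V x].

Definition tau_cover U : Prop :=
  large_cover U /\
  forall x y : X, finite_set [set V | [/\ U V, V x & ~ V y]] \/
                  finite_set [set V | [/\ U V, V y & ~ V x]].

Definition gamma_cover U : Prop :=
  [/\ is_cover U, infinite_set U &
      forall x : X, finite_set [set V | U V /\ ~ V x]].

Definition countable_open U : Prop := countable U /\ U `<=` open.

Definition Tau : set (set (set X)) :=
  [set U | countable_open U /\ tau_cover U].

Definition Gamma : set (set (set X)) :=
  [set U | countable_open U /\ gamma_cover U].

Definition has_finite_subcover U : Prop :=
  exists F : set (set X),
    [/\ finite_set F, F `<=` U & \bigcup_(V in F) V = [set: X]].

Definition S1 (A B : set (set (set X))) : Prop :=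
  forall U : nat -> set (set X), (forall n, A (U n)) ->
  exists V : nat -> set X, (forall n, U n (V n)) /\ B (range V).

Definition Ufin (A B : set (set (set X))) : Prop :=
  forall U : nat -> set (set X),
    (forall n, A (U n) /\ ~ has_finite_subcover (U n)) ->
  exists F : nat -> set (set X),
    (forall n, finite_set (F n) /\ F n `<=` U n) /\
    B (range (fun n => \bigcup_(V in F n) V)).

(* U_{[1,aleph_0)}(A, B) *)
Definition U1fin (A B : set (set (set X))) : Prop :=
  forall U : nat -> set (set X),
    (forall n, A (U n) /\ ~ has_finite_subcover (U n)) ->
  exists F : nat -> set (set X),
    (forall n, [/\ finite_set (F n), F n !=set0 & F n `<=` U n]) /\
    B (range (fun n => \bigcup_(V in F n) V)).

End Covers.

Arguments Tau X : clear implicits.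
Arguments Gamma X : clear implicits.

(* [A i : topologicalType] is the library's subtype [set_type (A i)], which
   carries the subspace topology. *)
Definition preserved_by_finite_unions (R : realType)
    (P : topologicalType -> Prop) : Prop :=
  forall X : topologicalType, set_of_reals R X ->
  forall (k : nat) (A : 'I_k -> set X),
    \bigcup_(i in [set: 'I_k]) A i = [set: X] ->
    (forall i, set_of_reals R (A i) /\ P (A i)) ->
    P X.

(* Main.v *)
Require Import Defs.
From mathcomp Require Import all_boot all_order all_algebra.
From mathcomp Require Import all_classical all_reals all_analysis.

Set Implicit Arguments.
Unset Strict Implicit.
Unset Printing Implicit Defensive.

Import Order.TTheory GRing.Theory Num.Theory.

Local Open Scope classical_set_scope.

(** The content is that [U1fin (Gamma X) (Tau X)] implies
    [Ufin (Gamma X) (Gamma X)].  The reverse implication is an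
    argument inside a single space, and [S1] is the case of one-element
    selections.

    Let [Y] be the disjoint union of two copies of [X], written [false] and
    [true].  Both copies are continuous images of [X], so they satisfy
    [U1fin (Gamma _) (Tau _)] with [X], and by the assumed preservation so
    does [Y].  Given covers [U n] of [X], take covers of [Y] that imitate [U n]
    on one copy and contain the whole of the other copy in each member: even
    indices work on the copy [false], odd ones on the copy [true].  Selecting
    nonempty finite subfamilies gives unions of the form [A false n] plus all
    of the copy [true], or [A true n] plus all of the copy [false].  For
    points [y] and [z] of [X], the members of this tau-cover that contain
    [(true, z)] but not [(false, y)] are those coming from the [n] with
    [y] outside [A false n]; symmetrically, those that contain [(false, y)] but
    not [(true, z)] come from the [n] with [z] outside [A true n].  The tau
    condition makes one of these two sets finite.  Hence either every [y] is
    in almost all [A false n], or every [z] is in almost all [A true n]: one of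
    the two sequences is a gamma-cover of [X].  Nonemptiness of the selections
    is what makes each member swallow the idle copy
    ([U1fin_two_copies_Ufin]).

    Covers are sets of sets, so finitely many members might come from infinitely
    many indices.  This is excluded by refining [U n] so that each member
    contains a point [x n] outside the first [n] members of [U 0], and is
    contained in a member of [U 0]: a set that is covered by the first [K]
    members of [U 0] can then occur only at indices below [K].  The passage
    between sets of sets and sequences is organised by [gamma_seq],
    [Gamma_enum] and [Gamma_range].

    Conversely, [Ufin (Gamma X) (Gamma X)] only allows possibly empty
    selections.  Replace [U n] by the intersections, index by index, of
    enumerations of [U 0], ..., [U n]; a selection at a later stage then
    induces one at stage [n], so every stage can borrow a nonempty selection
    from a later stage ([Ufin_Gamma_U1fin_Tau]). *)

(** * Sequences of sets that eventually contain each point *)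

Lemma near_infty_finiteP (P : nat -> Prop) :
  (\forall n \near \oo, P n) <-> finite_set [set n | ~ P n].
Proof.
split=> [[N _ PN]|/finite_seqP[s Es]].
  apply: (sub_finite_set _ (finite_II N)) => n /= nP.
  by rewrite ltnNge; apply/negP => /PN.
exists (\max_(i <- s) i).+1 => // n /= sn; apply: contrapT => nPn.
have : [set n | ~ P n] n by [].
rewrite Es /= => ns.
by have := leq_trans sn (@leq_bigmax_seq _ s xpredT (fun i => i) n ns isT);
  rewrite ltnn.
Qed.

Lemma finite_preimage_fibers (T : Type) (f : nat -> T) (B : set T) :
  (forall n, finite_set [set m | f m = f n]) ->
  finite_set (B `&` range f) -> finite_set (f @^-1` B).
Proof.
move=> fib finB.
apply: (@sub_finite_set _ _ (\bigcup_(V in B `&` range f) [set m | f m = V])).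
  by move=> n Bn; exists (f n) => //; split=> //; exists n.
by apply: bigcup_finite => // V [_ [n _ <-]]; exact: fib.
Qed.

(** An indexed version of gamma-covers: finiteness is counted over indices,
    whereas [gamma_cover] counts distinct members. *)
Definition gamma_seq (X : Type) (u : nat -> set X) : Prop :=
  (forall n, u n <> [set: X]) /\ forall x, \forall n \near \oo, u n x.

Lemma gamma_seq_shift (X : Type) (u : nat -> set X) K :
  gamma_seq u -> gamma_seq (fun k => u (K + k)).
Proof.
move=> [uT ux]; split=> // x; have [N _ uN] := ux x.
by exists N => // k /= Nk; apply: uN; rewrite /= (leq_trans Nk)// leq_addl.
Qed.

Section CoversOfASpace.
Variable X : topologicalType.
Implicit Types (U W : set (set X)) (u : nat -> set X).

(** A point outside [u n] is missed by every [u m] equal to [u n], hence by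
    finitely many terms only. *)
Lemma gamma_seq_fiber u n : gamma_seq u -> finite_set [set m | u m = u n].
Proof.
move=> [uT ux].
have [x nx] : exists x, ~ u n x.
  by apply: contrapT => /forallNP H; apply: (uT n); apply/seteqP; split=> // x _;
    apply: contrapT => /H.
have /near_infty_finiteP := ux x; apply: sub_finite_set => m /= -> //.
Qed.

Lemma Gamma_range u : (forall n, open (u n)) -> gamma_seq u ->
  Gamma X (range u).
Proof.
move=> uo gu; have [uT ux] := gu; split.
  split; last by move=> _ [n _ <-].
  exact: card_image_le.
split; first split.
- by move=> [n _ /uT].
- apply/seteqP; split=> // x _; have [N _ uN] := ux x.
  by exists (u N); [exists N|apply: uN => /=].
- move=> fin; apply: infinite_nat.
  rewrite -(preimage_setT u); apply: finite_preimage_fibers; last by rewrite setTI.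
  by move=> n; exact: gamma_seq_fiber.
- move=> x; have /near_infty_finiteP/(finite_image u) := ux x.
  by apply: sub_finite_set => _ [[n _ <-] nux]; exists n.
Qed.

Lemma Gamma_enum U : Gamma X U ->
  exists u, [/\ injective u, range u = U, gamma_seq u &
                forall n, open (u n)].
Proof.
move=> [[cU oU] [[nT _] iU fU]].
have := eq_card_nat cU iU; rewrite card_eq_sym.
move=> /card_set_bijP[u [fu inju surju]].
have ru : range u = U.
  by apply/seteqP; split=> // _ [n _ <-]; exact: fu.
have uinj : injective u by move=> i j; apply: inju; rewrite inE.
exists u; split=> //; last by move=> n; apply: oU; rewrite -ru; exists n.
split=> [n uT|x].
  by apply: nT; rewrite -uT -ru; exists n.
apply/near_infty_finiteP.
apply: (@sub_finite_set _ _ (u @^-1` [set V | U V /\ ~ V x])).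
  by move=> n /= nux; split=> //; rewrite -ru; exists n.
by apply: finite_preimage => // i j _ _; exact: uinj.
Qed.

Lemma Gamma_Tau : Gamma X `<=` Tau X.
Proof.
move=> U [coU [cU iU fU]]; split=> //; split; last first.
  by move=> x y; left; apply: sub_finite_set (fU y) => V [].
split=> // x; have := infinite_setD iU (fU x).
by apply: sub_infinite_set => V /= [UV /not_andP[//|/contrapT]].
Qed.

Lemma finite_union_neqT U F : ~ has_finite_subcover U ->
  finite_set F -> F `<=` U -> \bigcup_(V in F) V <> [set: X].
Proof. by move=> nU fF FU FT; apply: nU; exists F. Qed.

Lemma finite_unions_Gamma (U F : nat -> set (set X)) :
  (forall n, U n `<=` open) -> (forall n, ~ has_finite_subcover (U n)) ->
  (forall n, finite_set (F n) /\ F n `<=` U n) ->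
  (forall x, \forall n \near \oo, (\bigcup_(V in F n) V) x) ->
  Gamma X (range (fun n => \bigcup_(V in F n) V)).
Proof.
move=> oU nU hF ux; apply: Gamma_range.
  by move=> n; apply: bigcup_open => V /(hF n).2 /oU.
split=> // n; have [fF FU] := hF n; exact: finite_union_neqT FU.
Qed.

(** * Refinements *)

Definition refines W U := forall V, W V -> exists2 V', U V' & V `<=` V'.

Lemma refines_lift W U F : refines W U -> finite_set F -> F `<=` W ->
  exists G, [/\ finite_set G, G `<=` U,
    \bigcup_(V in F) V `<=` \bigcup_(V in G) V & F !=set0 -> G !=set0].
Proof.
move=> WU fF FW.
have /choice[g gP] : forall V, exists V', F V -> U V' /\ V `<=` V'.
  move=> V; have [FV|nFV] := pselect (F V); last by exists V.
  by have [V' ? ?] := WU _ (FW _ FV); exists V'.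
exists (g @` F); split; first exact: finite_image.
- by move=> _ [V FV <-]; exact: (gP V FV).1.
- by move=> x [V FV Vx]; exists (g V); [exists V|exact: (gP V FV).2].
- by move=> [V FV]; exists (g V); exists V.
Qed.

Lemma refines_nosubcover W U : refines W U ->
  ~ has_finite_subcover U -> ~ has_finite_subcover W.
Proof.
move=> WU + [F [fF FW FT]]; apply.
have [G [fG GU FG _]] := refines_lift WU fF FW.
by exists G; split=> //; apply/seteqP; split=> // x _; apply: FG; rewrite FT.
Qed.

(** The terms at [n] refine all the sequences [u i] with [i <= n] at once, and
    by taking intersections along a common index [k] they stay a
    gamma-sequence. *)
Definition meet_upto (u : nat -> nat -> set X) n k : set X :=
  [set x | forall i, (i <= n)%N -> u i k x].

Lemma meet_upto_sub (u : nat -> nat -> set X) n i k :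
  (i <= n)%N -> meet_upto u n k `<=` u i k.
Proof. by move=> ? x; apply. Qed.

(** Stated for an arbitrary filter: the neighborhoods of a point give openness,
    the eventual filter on indices gives the gamma property. *)
Lemma near_meet_upto (u : nat -> nat -> set X) n (T : Type) (F : set_system T)
    (k : T -> nat) (z : T -> X) : Filter F ->
  (forall i, (i <= n)%N -> \forall t \near F, u i (k t) (z t)) ->
  \forall t \near F, meet_upto u n (k t) (z t).
Proof.
move=> FF Fu.
have : \forall t \near F, forall i : 'I_n.+1, u i (k t) (z t).
  by apply: filter_forall => i; apply: Fu; rewrite -ltnS.
by apply: filterS => t ut i lin; apply: (ut (Ordinal (lin : (i < n.+1)%N))).
Qed.

Lemma open_meet_upto (u : nat -> nat -> set X) n k :
  (forall i k, open (u i k)) -> open (meet_upto u n k).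
Proof.
move=> uo; rewrite openE => x dx.
apply: (@near_meet_upto _ _ X _ (cst k) id) => i lin.
exact: open_nbhs_nbhs (conj (uo i k) (dx i lin)).
Qed.

Lemma gamma_seq_meet_upto (u : nat -> nat -> set X) n :
  (forall i, gamma_seq (u i)) -> gamma_seq (meet_upto u n).
Proof.
move=> gu; split=> [k dT|x].
  apply: ((gu 0%N).1 k); apply/seteqP; split=> // x _.
  by apply: (@meet_upto_sub u n 0); rewrite // dT.
by apply: (@near_meet_upto _ _ nat _ id (cst x)) => i _; exact: (gu i).2.
Qed.


(** * From possibly empty to nonempty selections *)

(** The unions selected from the refinements have infinitely many distinct
    values [v j], and all but finitely many of them contain [x0], hence come
    from nonempty selections.  Stage [n] uses some [v j] with [j >= n], found at
    an index [p j >= n] of the refinements. *)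
Lemma Ufin_Gamma_U1fin_Tau :
  Ufin (Gamma X) (Gamma X) -> U1fin (Gamma X) (Tau X).
Proof.
move=> H U hU.
have /choice[u uP] : forall n, exists u, [/\ injective u, range u = U n,
    gamma_seq u & forall k, open (u k)].
  by move=> n; exact: Gamma_enum (hU n).1.
have gu n : gamma_seq (u n) by case: (uP n).
have ou n : forall k, open (u n k) by case: (uP n).
have ru n : range (u n) = U n by case: (uP n).
have [x0 _] : exists x0, ~ u 0%N 0%N x0.
  apply: contrapT => /forallNP nx; apply: ((gu 0%N).1 0%N).
  by apply/seteqP; split=> // x _; apply: contrapT => /nx.
have ref n i : (i <= n)%N -> refines (range (meet_upto u n)) (U i).
  move=> lin _ [k _ <-]; exists (u i k); last exact: meet_upto_sub.
  by rewrite -ru; exists k.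
have [|F [hF GF]] := H (fun n => range (meet_upto u n)).
  move=> n; split; last exact: refines_nosubcover (ref _ _ (leqnn n)) (hU n).2.
  apply: Gamma_range; last exact: gamma_seq_meet_upto.
  by move=> k; exact: open_meet_upto.
have [v [vinj rv gv _]] := Gamma_enum GF.
have /choice[p pv] : forall j, exists p, \bigcup_(V in F p) V = v j.
  move=> j; have : range v (v j) by exists j.
  by rewrite rv => -[p _ <-]; exists p.
have pinj : injective p by move=> i j pij; apply: vinj; rewrite -!pv pij.
have /choice[j jP] : forall n, exists j, [/\ (n <= j)%N, (n <= p j)%N & v j x0].
  move=> n; near \oo => j; exists j; split; near: j.
  - exact: nbhs_infty_ge.
  (* [p] is injective, so it takes finitely many values below [n] *)
  - apply/near_infty_finiteP; apply: (@sub_finite_set _ _ (p @^-1` `I_n)).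
      by move=> j /= /negP; rewrite -ltnNge.
    by apply: finite_preimage (finite_II n) => a b _ _; exact: pinj.
  - exact: gv.2.
have /choice[G hG] : forall n, exists G, [/\ finite_set G, G `<=` U n,
    v (j n) `<=` \bigcup_(V in G) V & G !=set0].
  move=> n; have [lnj lnp vx] := jP n.
  have [fF FU] := hF (p (j n)).
  have [G [fG GU FG G0]] := refines_lift (ref _ _ lnp) fF FU.
  exists G; split=> //; first by rewrite -pv.
  apply: G0; move: vx; rewrite -pv => -[V FV _]; by exists V.
exists G; split; first by move=> n; have [] := hG n.
apply: Gamma_Tau; apply: (@finite_unions_Gamma U).
- by move=> n; have [[[]]] := hU n.
- by move=> n; have [] := hU n.
- by move=> n; have [] := hG n.
- move=> x; have [N _ vN] := gv.2 x; exists N => // n /= Nn.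
  have [lnj _ _] := jP n; have [_ _ + _] := hG n; apply.
  by apply: vN; exact: leq_trans lnj.
Unshelve. all: by end_near.
Qed.

Lemma S1_U1fin (A B : set (set (set X))) : S1 A B -> U1fin A B.
Proof.
move=> H U hU; have [|V [VU BV]] := H U; first by move=> n; exact: (hU n).1.
exists (fun n => [set V n]); split.
  move=> n; split; [exact: finite_set1|by exists (V n)|by move=> _ ->].
by under eq_fun do rewrite bigcup_set1.
Qed.

End CoversOfASpace.

(** * Continuous images *)

(** [phi] transports covers of [X] to covers of [Y], here either by preimage
    under a surjection or by extension from one summand of a disjoint union;
    [psi] recovers a cover of [X] from one of [Y]. *)
Lemma nosubcover_image (X Y : topologicalType) (phi : set X -> set Y)
    (psi : set Y -> set X) (U : set (set X)) :
  cancel phi psi ->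
  (forall F : set (set Y), F `<=` phi @` U -> \bigcup_(V in F) V = [set: Y] ->
     \bigcup_(V in F) psi V = [set: X]) ->
  ~ has_finite_subcover U -> ~ has_finite_subcover (phi @` U).
Proof.
move=> phiK psiT + [F [fF FU FT]]; apply; exists (psi @` F); split.
- exact: finite_image.
- by move=> _ [_ /FU[V UV <-] <-]; rewrite phiK.
- by rewrite bigcup_image; exact: psiT FU FT.
Qed.

Section ContinuousImage.
Variables (X Z : topologicalType) (f : X -> Z).
Hypothesis (fcont : continuous f) (fsurj : range f = [set: Z]).

Let preimageK : cancel (preimage f) (image^~ f).
Proof. by move=> V; apply: image_preimage. Qed.

Lemma gamma_seq_preimage (u : nat -> set Z) :
  gamma_seq u -> gamma_seq (fun n => f @^-1` u n).
Proof.
move=> [uT ux]; split=> [n fT|x]; last exact: ux (f x).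
by apply: (uT n); rewrite -(preimageK (u n)) fT.
Qed.

Lemma Gamma_preimage U : Gamma Z U -> Gamma X (preimage f @` U).
Proof.
move=> /Gamma_enum[u [_ <- gu uo]]; rewrite image_comp.
apply: (@Gamma_range X (preimage f \o u)).
  by move=> n; apply: (continuousP _).1.
exact: gamma_seq_preimage.
Qed.

Lemma Tau_of_preimage W : W `<=` open -> Tau X (preimage f @` W) -> Tau Z W.
Proof.
move=> oW [[cW _] [[[WT Wc] Wl] Wt]].
have WE : W = image^~ f @` (preimage f @` W).
  apply/seteqP; split=> [V WV|_ [_ [V WV <-] <-]]; last by rewrite preimageK.
  by exists (f @^-1` V); [exists V|exact: preimageK].
have fx z : exists x, f x = z.
  by have : [set: Z] z by []; rewrite -fsurj => -[x _ <-]; exists x.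
split.
  split=> //; rewrite WE; apply: sub_countable cW; exact: card_image_le.
split; first split; first split.
- by move=> WTZ; apply: WT; exists [set: Z].
- apply/seteqP; split=> // z _; have [x <-] := fx z.
  have : [set: X] x by [].
  by rewrite -Wc => -[_ [V WV <-] fVx]; exists V.
- move=> z; have [x <-] := fx z => fin; apply: (Wl x).
  apply: sub_finite_set (finite_image (preimage f) fin).
  by move=> _ [[V WV <-] Vx]; exists V.
- move=> z1 z2; have [x <-] := fx z1; have [y <-] := fx z2.
  by have [/(finite_image (image^~ f)) h|/(finite_image (image^~ f)) h] := Wt x y;
    [left|right]; apply: sub_finite_set h => V [WV V1 V2];
    exists (f @^-1` V) => //; split=> //; exists V.
Qed.

(** Pull the covers of [Z] back along [f], select there, and push the selection
    forward: since [f] is onto, preimage identifies the subsets of [Z] with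
    some subsets of [X], so counting members is not affected. *)
Lemma U1fin_Gamma_Tau_image :
  U1fin (Gamma X) (Tau X) -> U1fin (Gamma Z) (Tau Z).
Proof.
move=> H U hU.
have [|F [hF TF]] := H (fun n => preimage f @` U n).
  move=> n; have [GU nU] := hU n; split; first exact: Gamma_preimage.
  apply: nosubcover_image preimageK _ nU => F _ FT.
  by rewrite -image_bigcup FT.
have FE n : F n = preimage f @` (image^~ f @` F n).
  rewrite image_comp -[LHS]image_id; apply: eq_imagel => V /= FV.
  have [_ _ /(_ _ FV)[V' _ <-]] := hF n.
  by rewrite preimageK.
exists (fun n => image^~ f @` F n); split.
  move=> n; have [fF [V FV] FU] := hF n; split.
  - exact: finite_image.
  - by exists (f @` V); exists V.
  - by move=> _ [_ /FU[W UW <-] <-]; rewrite preimageK.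
apply: Tau_of_preimage.
  move=> _ [n _ <-]; apply: bigcup_open => _ [V FV <-].
  have [_ _ FU] := hF n; have [W UW <-] := FU _ FV.
  by rewrite preimageK; have [[[_ +] _] _] := hU n; apply.
rewrite image_comp; congr (Tau X _): TF.
apply: eq_imagel => n _ /=; rewrite preimage_bigcup.
by rewrite [in LHS](FE n) [in LHS]bigcup_image.
Qed.

Lemma separable_image : separable X -> separable Z.
Proof.
move=> [D cD dD]; exists (f @` D).
  by apply: sub_countable cD; exact: card_image_le.
move=> O [z Oz] oO.
have [x fxz] : exists x, f x = z.
  by have : [set: Z] z by []; rewrite -fsurj => -[x _ <-]; exists x.
have [||y [Oy Dy]] := dD (f @^-1` O).
- by exists x; rewrite /= fxz.
- exact: (continuousP _).1.
- by exists (f y); split=> //; exists y.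
Qed.

End ContinuousImage.

(** * Two copies of a space *)

Section TwoCopies.
Variable X : topologicalType.

Definition two_copies : topologicalType := {b : bool & X}.

Definition copy (b : bool) (x : X) : two_copies := existT (fun=> X) b x.

Lemma copy_continuous b : continuous (copy b).
Proof. exact: existT_continuous. Qed.

(** The extension of [B] from the copy [b] by the whole of the other copy. *)
Definition side (b : bool) (B : set X) : set two_copies :=
  [set y | projT1 y = b -> B (projT2 y)].

Lemma sideK b : cancel (side b) (preimage (copy b)).
Proof. by move=> B; apply/seteqP; split=> x /= Bx; [exact: Bx|]. Qed.

Lemma open_side b B : open B -> open (side b B).
Proof.
move=> oB; apply/sigT_openP => c; have [<-|nbc] := eqVneq b c.
  by have := sideK b B; rewrite /preimage /copy /= => ->.
rewrite (_ : _ @^-1` _ = setT); first exact: openT.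
by apply/seteqP; split=> // x _ cb; case/eqP: nbc; exact: esym cb.
Qed.

Lemma gamma_seq_side b (u : nat -> set X) :
  gamma_seq u -> gamma_seq (fun n => side b (u n)).
Proof.
move=> [uT ux]; split=> [n sT|[c x]].
  by apply: (uT n); rewrite -(sideK b (u n)) sT.
by have := ux x; apply: filterS => n unx _.
Qed.

(** The tau condition, tested on a point of the copy [true] against a point of
    the copy [false], separates the sets that are full on one copy from
    those that are full on the other. *)
Lemma U1fin_two_copies_Ufin :
  U1fin (Gamma two_copies) (Tau two_copies) -> Ufin (Gamma X) (Gamma X).
Proof.
move=> H U hU.
have /choice[u uP] : forall n, exists u, [/\ injective u, range u = U n,
    gamma_seq u & forall k, open (u k)].
  by move=> n; exact: Gamma_enum (hU n).1.
have gu n : gamma_seq (u n) by case: (uP n).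
have ou n : forall k, open (u n k) by case: (uP n).
have ru n : range (u n) = U n by case: (uP n).
have /choice[x xP] : forall n, exists x, forall i, (i < n)%N -> ~ u 0%N i x.
  move=> n; have ufin : finite_set (u 0%N @` `I_n).
    exact: finite_image (finite_II n).
  have uU : u 0%N @` `I_n `<=` U 0%N by rewrite -ru => _ [i _ <-]; exists i.
  have /setTPn[x nx] := introN eqP (finite_union_neqT (hU 0%N).2 ufin uU).
  by exists x => i lin uix; apply: nx; exists (u 0%N i) => //; exists i.
(* The shift by [K n] keeps only the members that contain [x n]. *)
have /choice[K KP] : forall n, exists K, forall k,
    meet_upto u n (K + k) (x n).
  move=> n; have [K _ hK] := (gamma_seq_meet_upto n gu).2 (x n).
  by exists K => k; apply: hK; rewrite /= leq_addr.
pose r n k := meet_upto u n (K n + k).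
have gr n : gamma_seq (r n).
  exact: gamma_seq_shift (gamma_seq_meet_upto n gu).
have ref n i : (i <= n)%N -> refines (range (r n)) (U i).
  move=> lin _ [k _ <-]; exists (u i (K n + k)%N); last exact: meet_upto_sub.
  by rewrite -ru; exists (K n + k)%N.
have nr n : ~ has_finite_subcover (range (r n)).
  exact: refines_nosubcover (ref _ _ (leqnn n)) (hU n).2.
pose W m := side (odd m) @` range (r m./2).
have [|F [hF [[cF oF] [[[FT Fc] Fl] Ft]]]] := H W.
  move=> m; split.
    rewrite /W image_comp; apply: (@Gamma_range _ (side (odd m) \o r m./2)).
      by move=> k; apply: open_side; apply: open_meet_upto.
    exact: gamma_seq_side.
  apply: nosubcover_image (sideK _) _ (nr _) => G _ GT.
  by rewrite -preimage_bigcup GT.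
pose S m := \bigcup_(V in F m) V.
(* The cover number [b + n.*2] imitates [U n] on the copy [b]. *)
pose A b n := copy b @^-1` S (b + n.*2)%N.
have Sm (b : bool) n : side b (A b n) = S (b + n.*2)%N.
  rewrite /A /S; have [_ [V0 FV0] FW] := hF (b + n.*2)%N.
  have ob : odd (b + n.*2) = b by rewrite oddD odd_double addbF oddb.
  apply/seteqP; split=> [[c y]|[c y] [V FV Vy] /= cb]; last first.
    by have {}cb : c = b := cb; subst c; exists V; [exact: FV|exact: Vy].
  have [->|ncb] := eqVneq c b; first by apply.
  (* [V0] is full on the copy [c]; this is where nonempty selections matter *)
  move=> _; exists V0 => //; have [B _ <-] := FW _ FV0.
  by rewrite ob => cb; case/eqP: ncb.
have Ag (b : bool) n : exists G, [/\ finite_set G, G `<=` range (r n) &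
    A b n = \bigcup_(V in G) V].
  have [fF _ FW] := hF (b + n.*2)%N.
  have ob : odd (b + n.*2) = b by rewrite oddD odd_double addbF oddb.
  have hb : (b + n.*2)./2 = n by rewrite half_bit_double.
  exists (preimage (copy b) @` F (b + n.*2)%N); split.
  - exact: finite_image.
  - by move=> _ [_ /FW[V + <-] <-]; rewrite hb ob sideK.
  - by rewrite bigcup_image /A preimage_bigcup.
have Ax b n : A b n (x n).
  rewrite /A /S; have [_ [V FV] FW] := hF (b + n.*2)%N.
  exists V => //; have [_ [k _ <-] <-] := FW _ FV.
  by move=> _ /=; rewrite half_bit_double; exact: KP.
(* [A b n] is covered by finitely many members of [U 0], which are among the
   first [N]; but [A b m] contains [x m], which avoids them as soon as
   [N <= m]. *)
have Afib b n : finite_set [set m | A b m = A b n].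
  have [G [fG Gr AG]] := Ag b n.
  have [G' [fG' G'U GG' _]] := refines_lift (ref n 0%N (leq0n n)) fG Gr.
  have [uinj _ _ _] := uP 0%N.
  have : finite_set (u 0%N @^-1` G').
    by apply: finite_preimage => // i j _ _; exact: uinj.
  have -> : u 0%N @^-1` G' = [set i | ~ (~` (u 0%N @^-1` G')) i].
    by apply/seteqP; split=> i /=; [move=> ? /(_ _)|move=> /contrapT].
  move=> /near_infty_finiteP[N _ hN].
  apply: sub_finite_set (finite_II N) => m /= Am; rewrite ltnNge.
  apply/negP => Nm; have := Ax b m; rewrite Am AG => /GG'[V G'V Vx].
  have := G'U _ G'V; rewrite -ru => -[i _ uiV]; subst V.
  apply: (xP m i) => //; rewrite ltnNge; apply/negP => mi.
  by apply: (hN i) => //=; exact: leq_trans mi.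
(* Finiteness over members becomes finiteness over indices. *)
have key (b : bool) (P : set (set two_copies)) :
    finite_set (range S `&` P) -> \forall n \near \oo, ~ P (side b (A b n)).
  move=> fP; apply/near_infty_finiteP.
  have -> : [set n | ~ ~ P (side b (A b n))] = (side b \o A b) @^-1` P.
    by apply/seteqP; split=> n /=; [move/contrapT|move=> ?; exact].
  apply: finite_preimage_fibers.
    move=> n; apply: sub_finite_set (Afib b n) => m /=.
    by move/(can_inj (sideK b)).
  apply: sub_finite_set fP => V [PV [n _ SV]]; split=> //.
  by rewrite -SV /= Sm; exists (b + n.*2)%N.
have [b Ab] : exists b, forall y, \forall n \near \oo, A b n y.
  apply: contrapT => /forallNP nb.
  have /existsNP[y ny] := nb false; have /existsNP[z nz] := nb true.
  have [fin|fin] := Ft (copy true z) (copy false y).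
  - apply: ny; have := @key false
      [set V | V (copy true z) /\ ~ V (copy false y)].
    rewrite (_ : _ `&` _ = [set V | [/\ range S V, V (copy true z) &
      ~ V (copy false y)]]); last first.
      by apply/seteqP; split=> [V [? []]|V []].
    move=> /(_ fin); apply: filterS => n nP.
    by apply: contrapT => nA; apply: nP; split=> // /(_ erefl).
  - apply: nz; have := @key true
      [set V | V (copy false y) /\ ~ V (copy true z)].
    rewrite (_ : _ `&` _ = [set V | [/\ range S V, V (copy false y) &
      ~ V (copy true z)]]); last first.
      by apply/seteqP; split=> [V [? []]|V []].
    move=> /(_ fin); apply: filterS => n nP.
    by apply: contrapT => nA; apply: nP; split=> // /(_ erefl).
have /choice[G GP] : forall n, exists G, [/\ finite_set G, G `<=` U n &
    A b n `<=` \bigcup_(V in G) V].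
  move=> n; have [G [fG Gr ->]] := Ag b n.
  by have [G' [? ? ? _]] := refines_lift (ref _ _ (leqnn n)) fG Gr; exists G'.
exists G; split; first by move=> n; have [] := GP n.
apply: (@finite_unions_Gamma _ U).
- by move=> n; have [[[]]] := hU n.
- by move=> n; have [] := hU n.
- by move=> n; have [] := GP n.
- by move=> y; have := Ab y; apply: filterS => n; have [_ _] := GP n; apply.
Qed.

End TwoCopies.

(** * Sets of reals: subspaces and two copies *)

Section Subspace.
Variables (X : topologicalType) (A : set X).

Lemma set_val_continuous : continuous (set_val : A -> X).
Proof. exact: initial_continuous. Qed.

Lemma nbhs_set_type (x : A) (U : set A) :
  nbhs x U <-> exists2 W, nbhs (set_val x) W & set_val @^-1` W `<=` U.
Proof.
split=> [[_ [[W oW <-] Wx WU]]|[W Wx WU]].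
  by exists W => //; exact: open_nbhs_nbhs.
by apply: filterS WU _; exact: set_val_continuous.
Qed.

Lemma clopen_base_subspace : clopen_base X -> clopen_base A.
Proof.
move=> cb x U /nbhs_set_type[W /cb[V [cV Vx VW]] WU].
exists (set_val @^-1` V); split=> //; last by move=> y /VW /WU.
by apply: preimage_clopen => //; exact: set_val_continuous.
Qed.

Lemma metrizable_subspace (R : realType) : metrizable R X -> metrizable R A.
Proof.
move=> [d [d0 deq dC dtri dnbhs]].
exists (fun x y => d (set_val x) (set_val y)); split=> // [x y /deq|x U].
  exact: val_inj.
split=> [/nbhs_set_type[W /dnbhs[e e0 eW] WU]|[e e0 eU]].
  by exists e => // y /eW /WU.
apply/nbhs_set_type; exists [set y | d (set_val x) y < e]%R => //.
by apply/dnbhs; exists e.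
Qed.

End Subspace.

Section TwoCopiesOfASetOfReals.
Local Open Scope ring_scope.
Variables (R : realType) (X : topologicalType).

Lemma copy_inj b : injective (@copy X b).
Proof. by move=> x y /(congr1 (fun z : two_copies X => projT2 z : X)). Qed.

Lemma clopen_copy b (V : set X) : clopen V -> clopen (copy b @` V).
Proof.
move=> [oV cV]; split; first exact: existT_open_map.
rewrite -openC; apply/sigT_openP => c; have [<-|nbc] := eqVneq b c.
  rewrite (_ : _ @^-1` _ = ~` V); first exact: closed_openC.
  by apply/seteqP; split=> x /= nV; [move=> Vx; apply: nV; exists x|
    move=> [y Vy /copy_inj xy]; apply: nV; rewrite -xy].
rewrite (_ : _ @^-1` _ = setT); first exact: openT.
apply/seteqP; split=> // x _ [y _ /(congr1 (fun z : two_copies X => projT1 z)) bc].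
by case/eqP: nbc.
Qed.

Lemma clopen_base_two_copies : clopen_base X -> clopen_base (two_copies X).
Proof.
move=> cb [b x] U /= /cb[V [cV Vx VU]].
exists (copy b @` V); split; first exact: clopen_copy.
- by exists x.
- by move=> _ [y /VU Uy <-].
Qed.

Lemma separable_two_copies : separable X -> separable (two_copies X).
Proof.
move=> [D cD dD]; exists (\bigcup_b copy b @` D).
  apply: bigcup_countable => // b _.
  by apply: sub_countable cD; exact: card_image_le.
move=> U [[b x] Ux] /sigT_openP/(_ b) oU.
have [|y [Uy Dy]] := dD _ _ oU; first by exists x.
by exists (copy b y); split=> //; exists b => //; exists y.
Qed.

(** The metric adds 1 to the distance of points in different copies.  It is
    not a constant between copies, as the triangle inequality would then
    fail for points that are far apart in the same copy. *)
Lemma metrizable_two_copies : metrizable R X -> metrizable R (two_copies X).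
Proof.
move=> [d [d0 deq dC dtri dnbhs]].
have dge0 x y : 0 <= d x y.
  have := dtri x y x; rewrite d0 (dC y x) -mulr2n => h.
  by rewrite -(pmulrn_lge0 _ (ltn0Sn 1)).
pose D (y z : two_copies X) : R :=
  d (projT2 y) (projT2 z) + (projT1 y != projT1 z)%:R.
exists D; split.
- by move=> y; rewrite /D d0 eqxx addr0.
- move=> [b x] [c y]; rewrite /D /= => /eqP.
  rewrite paddr_eq0// => /andP[/eqP/deq-> ].
  by have [->|] := eqVneq b c => //; rewrite oner_eq0.
- by move=> y z; rewrite /D dC eq_sym.
- move=> [b x] [c y] [e z]; rewrite /D /= addrACA lerD//.
  by case: b c e => -[] [] /=; rewrite -natrD ler_nat.
- move=> [b x] U; split=> [/dnbhs[e e0 eU]|[e e0 eU]].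
    exists (Num.min e 1); first by rewrite lt_min e0 ltr01.
    move=> [c y] /=; rewrite /D /= lt_min => /andP[].
    have [<- + _|_ _] := eqVneq b c; last by rewrite gtrDr ltNge dge0.
    by rewrite addr0; exact: eU.
  apply/dnbhs; exists e => // y dxy; apply: eU.
  by rewrite /= /D /= eqxx addr0.
Qed.

Lemma set_of_reals_two_copies :
  set_of_reals R X -> set_of_reals R (two_copies X).
Proof.
move=> [iX cX sX mX]; split.
- move=> fin; apply: iX; rewrite -(preimage_setT (@copy X true)).
  by apply: finite_preimage fin => x y _ _; exact: copy_inj.
- exact: clopen_base_two_copies.
- exact: separable_two_copies.
- exact: metrizable_two_copies.
Qed.

(** [copy b] with its range as codomain, the subspace that enters the finite
    union. *)
Definition to_copy b (x : X) : range (@copy X b) :=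
  SigSub (mem_set (imageT (@copy X b) x)).

Lemma to_copy_continuous b : continuous (to_copy b).
Proof.
move=> x U /nbhs_set_type[W Wx WU].
have : nbhs x (copy b @^-1` W) by exact: (@copy_continuous X b).
by apply: filterS => y Wy; exact: WU.
Qed.

Lemma to_copy_surj b : range (to_copy b) = [set: range (@copy X b)].
Proof.
apply/seteqP; split=> // y _; have [x _ xy] := set_valP y.
by exists x => //; apply: val_inj.
Qed.

Lemma set_of_reals_copy b :
  set_of_reals R X -> set_of_reals R (range (@copy X b)).
Proof.
move=> hX; have [iX _ sX _] := hX.
have [_ cY _ mY] := set_of_reals_two_copies hX; split.
- move=> fin; apply: iX.
  rewrite -(preimage_setT (to_copy b)); apply: finite_preimage fin.
  by move=> x y _ _ /(congr1 set_val) /copy_inj.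
- exact: clopen_base_subspace.
- exact: separable_image (@to_copy_continuous b) (to_copy_surj b) sX.
- exact: metrizable_subspace.
Qed.

End TwoCopiesOfASetOfReals.

(** * The equivalence *)

Theorem corollary2p7 (R : realType)
  (hunion : preserved_by_finite_unions R
              (fun X : topologicalType => U1fin (Gamma X) (Tau X))) :
  (forall X : topologicalType, set_of_reals R X ->
     (U1fin (Gamma X) (Tau X) <-> Ufin (Gamma X) (Gamma X))) /\
  (forall X : topologicalType, set_of_reals R X ->
     S1 (Gamma X) (Tau X) -> Ufin (Gamma X) (Gamma X)).
Proof.
have main (X : topologicalType) : set_of_reals R X ->
    U1fin (Gamma X) (Tau X) -> Ufin (Gamma X) (Gamma X).
  move=> hX UX; apply: U1fin_two_copies_Ufin.
  pose A (i : 'I_2) := range (@copy X (i == ord0)).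
  apply: (hunion (two_copies X) (set_of_reals_two_copies hX) 2%N A) => [|i].
    apply/seteqP; split=> // -[b x] _.
    exists (if b then ord0 else ord_max) => //.
    by exists x => //; case: b.
  split; first exact: set_of_reals_copy.
  exact: U1fin_Gamma_Tau_image (@to_copy_continuous X _) (to_copy_surj _ _) UX.
split=> X hX; last by move=> /S1_U1fin; exact: main.
by split; [exact: main|exact: Ufin_Gamma_U1fin_Tau].
Qed.
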